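(* Let $S^-$ be the set of $\mathcal{P}$-positions of Triangle Game under misère play. Then $S^-=S^-_1\cup S^-_2$, where $$S^-_1=\{(1,0,0),(0,1,0),(0,0,1),(1,1,1)\},$$ $$S^-_2=\{(a,b,c),(b,c,a),(c,a,b)\mid a,b,c\in\mathbb{Z}_{\ge 0},\ a=b+c\ge 2,\ b\ge \phi c\},$$ and $\phi=\frac{1+\sqrt{5}}{2}$.
   Context: $\mathbb{Z}_{\ge 0}$ is the set of non-negative integers. Triangle Game is the two-player impartial game with set of positions $M=(\mathbb{Z}_{\ge 0})^3$, where the set of options (positions reachable in one move) of $(x,y,z)\in M$ is $$f((x,y,z))=\{(x-i,y+j,z)\mid 1\le i\le x,\ 0\le j<i\}\cup\{(x,y-i,z+j)\mid 1\le i\le y,\ 0\le j<i\}\cup\{(x+j,y,z-i)\mid 1\le i\le z,\ 0\le j<i\}$$ ($i,j$ integers). The two players alternately move from the current position to one of its options. Each move strictly decreases the total $x+y+z$, so every play is finite; the only terminal position (position with no options) is $(0,0,0)$. Under misère play, the player who makes the last move loses (a player unable to move wins). A position is a $\mathcal{P}$-position if the previous player (the player not about to move) has a winning strategy. Equivalently, under misère play, a position is a $\mathcal{P}$-position if and only if it is non-terminal and none of its options is a $\mathcal{P}$-position (so terminal positions are not $\mathcal{P}$-positions). *)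

(* Defs.v *)
From mathcomp Require Import all_boot all_order all_algebra.
From mathcomp Require Import boolp classical_sets reals.

Set Implicit Arguments.
Unset Strict Implicit.
Unset Printing Implicit Defensive.

Import Order.TTheory GRing.Theory Num.Theory.

Local Open Scope classical_set_scope.

(* An impartial game is given by its option map [f : T -> set T].  The
   definitions below are meant for games all of whose plays are finite. *)

Definition terminal (T : Type) (f : T -> set T) (p : T) : Prop := f p = set0.

(* [u 0, ..., u n] is a complete play from [p]; the values of [u] beyond [n]
   are irrelevant. *)
Definition complete_play (T : Type) (f : T -> set T) (p : T) (n : nat)
    (u : nat -> T) : Prop :=
  [/\ u 0 = p, forall k, k < n -> f (u k) (u k.+1) & terminal f (u n)].

Definition strategy (T : Type) (f : T -> set T) (s : T -> T) : Prop :=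
  forall p, ~ terminal f p -> f p (s p).

(* The player about to move at [u 0] makes the moves from [u k] with [k] even,
   the previous player those from [u k] with [k] odd. *)
Definition previous_follows (T : Type) (s : T -> T) (n : nat)
    (u : nat -> T) : Prop :=
  forall k, k < n -> odd k -> u k.+1 = s (u k).

(* In misere play the player facing the terminal position [u n] wins; this is
   the previous player exactly when [n] is odd. *)
Definition misere_P_position (T : Type) (f : T -> set T) (p : T) : Prop :=
  exists s : T -> T, strategy f s /\
    forall n u, complete_play f p n u -> previous_follows s n u -> odd n.

Definition position : Type := (nat * nat * nat)%type.

Definition triangle_options (p : position) : set position :=
  let: (x, y, z) := p in
  [set q | exists i j : nat,
     [/\ 1 <= i <= x, 0 <= j < i & q = (x - i, y + j, z)]] `|`
  [set q | exists i j : nat,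
     [/\ 1 <= i <= y, 0 <= j < i & q = (x, y - i, z + j)]] `|`
  [set q | exists i j : nat,
     [/\ 1 <= i <= z, 0 <= j < i & q = (x + j, y, z - i)]].

Definition golden_ratio (R : realType) : R := ((1 + Num.sqrt 5) / 2)%R.

Definition S_minus : set position := misere_P_position triangle_options.

Definition S_minus1 : set position :=
  [set (1, 0, 0); (0, 1, 0); (0, 0, 1); (1, 1, 1)].

Definition S_minus2 (R : realType) : set position :=
  [set p | exists a b c : nat,
     [/\ p = (a, b, c) \/ p = (b, c, a) \/ p = (c, a, b),
         a = b + c, b + c >= 2 &
         (b%:R >= golden_ratio R * c%:R)%R]].

(* Main.v *)
(* For natural numbers, [phi c <= b] means [b c + c^2 <= b^2].  The claimed set
   avoids the terminal position, no move joins two of its elements, and every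
   nonterminal position outside it has a move into it; this characterizes the
   P-positions.  By cyclic symmetry one may take an element of the set to be
   [(b + c, b, c)], and the first coordinate of a position outside it to be
   maximal.  The key fact is that [phi c <= b] and [phi (b - c) <= c] are
   complementary for [0 < c <= b], since [phi] is irrational. *)
Require Import Defs.
From mathcomp Require Import all_boot all_order all_algebra.
From mathcomp Require Import boolp classical_sets reals.
From mathcomp Require Import zify ring lra.

Import Order.TTheory GRing.Theory Num.Theory.

Local Open Scope classical_set_scope.

(** * Misère P-positions of a game with a decreasing measure *)

Section MiserePositions.

Context {T : Type} (f : T -> set T) (m : T -> nat) (S : set T).
Hypothesis m_decr : forall p q, f p q -> m q < m p.
Hypothesis S_nonterminal : forall p, S p -> ~ terminal f p.
Hypothesis S_stable : forall p q, S p -> f p q -> ~ S q.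
Hypothesis S_absorbing : forall p, ~ S p -> ~ terminal f p ->
  exists2 q, f p q & S q.

Lemma strategy_into :
  exists2 t, strategy f t & forall p, ~ S p -> ~ terminal f p -> S (t p).
Proof.
(* The choice must be total, so a terminal [p] gets the dummy value [p]. *)
have next p : exists q, ~ terminal f p -> f p q /\ (~ S p -> S q).
  have [tp|ntp] := pselect (terminal f p); first by exists p.
  have [Sp|nSp] := pselect (S p).
    have /set0P [q fpq] : f p != set0 by exact/eqP.
    by exists q.
  by have [q fpq Sq] := S_absorbing p nSp ntp; exists q.
have [t tP] := choice next.
exists t => p => [/tP [] //|nSp /tP [_]]; exact.
Qed.

(** A player who moves from outside [S] by [t] always hands over a position in [S] and gets back one
    outside [S]. Terminal positions lie outside [S], so this player is the one who faces the end,
    and wins. *)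
Lemma misere_P_positionE : misere_P_position f = S.
Proof.
have [t t_strat t_into] := strategy_into.
apply/seteqP; split => p.
- case=> s [s_strat s_wins]; apply: contrapT => nSp.
  (* The player about to move at [p] uses [t] against [s]. This sequence runs on past the end of the
     play, hence the least terminal index [n] below. *)
  pose fix u k := if k is k'.+1 then (if odd k' then s else t) (u k') else p.
  have step k : ~ terminal f (u k) -> f (u k) (u k.+1).
    by move=> ntk /=; case: (odd k); [exact: s_strat|exact: t_strat].
  have [n0 tn0] : exists n, terminal f (u n).
    apply: contrapT => /forallNP nt.
    have bound k : k + m (u k) <= m p.
      elim: k => [//|k IHk]; apply: leq_trans IHk.
      by rewrite addSnnS leq_add2l m_decr //; apply: step.
    by have := leq_trans (leq_addr _ _) (bound (m p).+1); rewrite ltnn.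
  have ex_n : exists n, `[< terminal f (u n) >] by exists n0; apply/asboolP.
  have [n /asboolP tn n_min] := ex_minnP ex_n.
  have nt k : k < n -> ~ terminal f (u k).
    by move=> kn /asboolP /n_min; rewrite leqNgt kn.
  have inv k : k <= n -> if odd k then S (u k) else ~ S (u k).
    elim: k => [//|k IHk] kn; have ntk := nt k kn.
    have := IHk (ltnW kn); have := step k ntk; rewrite /=; case: (odd k) => /=.
      by move=> fk Sk; exact: S_stable fk.
    by move=> _ nSk; exact: t_into.
  have odd_n : odd n.
    apply: (s_wins n u); first by split => // k /nt; exact: step.
    by move=> k _ /= ->.
  by have := inv n (leqnn n); rewrite odd_n => /S_nonterminal.
- move=> Sp; exists t; split=> // n u [u0 u_step tn] follows.
  have inv k : k <= n -> if odd k then ~ S (u k) else S (u k).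
    elim: k => [|k IHk] kn; first by rewrite u0.
    have fk := u_step k kn; have := IHk (ltnW kn); rewrite /=.
    case: ifPn => ok /= Sk; last exact: S_stable fk.
    rewrite follows //; apply: t_into => // tk.
    by move: fk; rewrite tk.
  by have := inv n (leqnn n); case: (odd n) => // /S_nonterminal.
Qed.

End MiserePositions.

(** * The golden ratio inequality over the naturals *)

Definition golden (b c : nat) : bool := b * c + c * c <= b * b.

Lemma golden0 b : golden b 0.
Proof. by rewrite /golden !muln0. Qed.

Lemma golden_lt b c : 0 < c -> golden b c -> c < b.
Proof. rewrite /golden; nia. Qed.

Lemma golden_leq b c d : d <= c -> golden b c -> golden b d.
Proof. rewrite /golden; nia. Qed.

(* Descent: a solution [(b, c)] yields the smaller solution [(c, b - c)]. *)
Lemma golden_irrational b c : b * b = b * c + c * c -> c = 0.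
Proof.
elim/ltn_ind: b c => b IHb c eq_bc; apply/eqP; rewrite -leqn0 leqNgt.
apply/negP => c_gt0.
have c_lt_b : c < b by nia.
have := IHb c c_lt_b (b - c); nia.
Qed.

(** With [b = c + d], the inequality [b * b < b * c + c * c] reads [c * d + d * d < c * c]. *)
Lemma golden_sub b c : c <= b -> ~~ golden b c -> golden c (b - c).
Proof.
move=> /subnKC; move: (b - c) => d <-; rewrite /golden -ltnNge; nia.
Qed.

(** By the same substitution, the two inequalities together would force [b * b = b * c + c * c]. *)
Lemma golden_subN b c : 0 < c -> golden b c -> ~~ golden c (b - c).
Proof.
move=> c_gt0 bc; apply/negP => cd.
have c_le_b := ltnW (golden_lt _ _ c_gt0 bc).
suff : c = 0 by lia.
apply: (golden_irrational b); move: bc cd; rewrite /golden.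
by move: c_le_b => /subnKC; move: (b - c) => d <-; nia.
Qed.

Lemma golden_ratioP (R : realType) (b c : nat) :
  (golden_ratio R * c%:R <= b%:R)%R = golden b c.
Proof.
have sq5 : (Num.sqrt 5 ^+ 2 = 5 :> R)%R by rewrite sqr_sqrtr.
have s_gt1 : (1 < Num.sqrt 5 :> R)%R.
  by rewrite -[X in (X < _)%R]sqrtr1 ltr_sqrt // ltr1n.
rewrite /golden -(ler_nat R) natrD !natrM /golden_ratio.
move: (Num.sqrt 5)%R sq5 s_gt1 => s sq5 s_gt1.
have := ler0n R b; have := ler0n R c.
move: (b%:R)%R (c%:R)%R => {b c} x y y0 x0.
(* The roots in [x] are [phi * y] and [(1 - phi) * y], and the second factor is nonnegative. *)
have factor : (x * x - (x * y + y * y) =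
    (x - (1 + s) / 2 * y) * (x + (s - 1) / 2 * y))%R.
  have -> : ((x - (1 + s) / 2 * y) * (x + (s - 1) / 2 * y) =
    x * x - x * y - (s ^+ 2 - 1) / 4 * (y * y))%R by field.
  by rewrite sq5; field.
rewrite -[LHS]subr_ge0 -[RHS]subr_ge0 factor.
have : (0 <= x + (s - 1) / 2 * y)%R by nra.
rewrite le_eqVlt => /predU1P [eq0|]; last by move=> /pmulr_lge0 ->.
(* The second factor vanishes only at [x = y = 0], where both inequalities hold. *)
have y_eq0 : (y = 0)%R by apply: le_anti; rewrite y0 andbT leNgt; apply/negP; nra.
by rewrite -eq0 mulr0 lexx y_eq0 mulr0 subr0 x0.
Qed.

(** * The claimed set as a cyclically symmetric boolean predicate *)

Definition apex (x y z : nat) : bool :=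
  [&& x == y + z, 2 <= x & golden y z].

Definition misere_set (x y z : nat) : bool :=
  [|| (x + y + z == 1), [&& x == 1, y == 1 & z == 1],
      apex x y z, apex y z x | apex z x y].

Lemma misere_setC x y z : misere_set x y z = misere_set y z x.
Proof. by rewrite /misere_set; lia. Qed.

Lemma misere_setE (R : realType) x y z :
  (S_minus1 `|` S_minus2 R) (x, y, z) <-> misere_set x y z.
Proof.
have S1E : S_minus1 (x, y, z) <->
    (x + y + z == 1) || [&& x == 1, y == 1 & z == 1].
  split=> [[[[|]|]|] [-> -> ->] //|/orP [xyz1|]].
    have [[-> -> ->]|[-> -> ->]|[-> -> ->]] :
        [\/ [/\ x = 1, y = 0 & z = 0], [/\ x = 0, y = 1 & z = 0]
          | [/\ x = 0, y = 0 & z = 1]].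
      have [x0|[y0|z0]] : x = 1 \/ y = 1 \/ z = 1 by lia.
      - by apply: Or31; split; lia.
      - by apply: Or32; split; lia.
      - by apply: Or33; split; lia.
    - by do 3 left.
    - by left; left; right.
    - by left; right.
  by case/and3P => /eqP -> /eqP -> /eqP ->; right.
have S2E : S_minus2 R (x, y, z) <-> [|| apex x y z, apex y z x | apex z x y].
  split=> [[a [b [c [pE aE bc2]]]]|].
    rewrite golden_ratioP => bc; move: pE; rewrite {}aE.
    have abc : apex (b + c) b c by rewrite /apex eqxx bc2.
    by case=> [|[|]] [-> -> ->]; rewrite abc ?orbT.
  case/or3P => /and3P [/eqP ->]; rewrite -(golden_ratioP R) => a2 bc.
  - by exists (y + z), y, z; split=> //; left.
  - by exists (z + x), z, x; split=> //; right; right.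
  - by exists (x + y), x, y; split=> //; right; left.
rewrite /misere_set orbA; split.
  by case=> [/S1E|/S2E] ->; rewrite ?orbT.
by case/orP => [/S1E|/S2E]; [left|right].
Qed.

(** * No move joins two elements of the set *)

Lemma triangle_optionsC x y z x' y' z' :
  triangle_options (x, y, z) (x', y', z') ->
  triangle_options (y, z, x) (y', z', x').
Proof.
case=> [[]|] [i [j [i_le j_lt [-> -> ->]]]].
- by right; exists i, j.
- by left; left; exists i, j.
- by left; right; exists i, j.
Qed.

Lemma triangle_options_total x y z x' y' z' :
  triangle_options (x, y, z) (x', y', z') -> x' + y' + z' < x + y + z.
Proof. by case=> [[]|] [i [j [i_le j_lt [-> -> ->]]]]; lia. Qed.

Lemma apex_stable x y z x' y' z' : apex x y z ->
  triangle_options (x, y, z) (x', y', z') -> ~~ misere_set x' y' z'.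
Proof.
case/and3P => /eqP -> yz2 gyz.
have z_lt_y : z < y by case: (posnP z) => [|/golden_lt]; [lia|exact].
case=> [[]|] [i [j [i_le j_lt [-> -> ->]]]]; last 2 first.
- by rewrite /misere_set /apex; lia.
- by rewrite /misere_set /apex; lia.
(* The one case beyond linear arithmetic: [i + j = 2 * z], so [i <= 2 * z] and [y - z <= y + z - i].
   Then [golden z (y - z)] would follow, against [golden_subN]. *)
suff : ~~ apex (y + j) z (y + z - i) by rewrite /misere_set /apex; lia.
apply/negP => /and3P [/eqP yj _ gz].
have z_gt0 : 0 < z by lia.
move: (golden_subN _ _ z_gt0 gyz); rewrite (golden_leq _ _ _ _ gz) //; lia.
Qed.

Lemma misere_set_stable x y z x' y' z' : misere_set x y z ->
  triangle_options (x, y, z) (x', y', z') -> ~~ misere_set x' y' z'.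
Proof.
case/or3P => [xyz1 opt|/and3P [/eqP -> /eqP -> /eqP ->]|/or3P [a|a|a] opt].
- have := triangle_options_total _ _ _ _ _ _ opt.
  by rewrite /misere_set /apex; lia.
- by case=> [[]|] [i [j [i_le j_lt [-> -> ->]]]]; rewrite /misere_set /apex; lia.
- exact: apex_stable opt.
- by rewrite misere_setC (apex_stable _ _ _ _ _ _ a) //; exact: triangle_optionsC.
- rewrite 2!misere_setC (apex_stable _ _ _ _ _ _ a) //.
  exact/triangle_optionsC/triangle_optionsC.
Qed.

(** * Moves into the set from outside *)

Definition has_move_into (x y z : nat) : Prop := exists x' y' z',
  triangle_options (x, y, z) (x', y', z') /\ misere_set x' y' z'.

Lemma has_move_intoC x y z : has_move_into x y z -> has_move_into y z x.
Proof.
move=> [x' [y' [z' [opt Sp']]]]; exists y', z', x'.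
by rewrite -misere_setC; split=> //; exact: triangle_optionsC.
Qed.

(** For [i = x - x'] and [j = y' - y], the constraint [j < i] says that the sum of the two
    coordinates drops. *)
Lemma lower_first x y z x' y' : x' < x -> y <= y' -> x' + y' < x + y ->
  misere_set x' y' z -> has_move_into x y z.
Proof.
move=> lt_x le_y lt_xy Sp'; exists x', y', z; split=> //.
by left; left; exists (x - x'), (y' - y); split; [lia|lia|congr (_, _, _); lia].
Qed.

Lemma lower_last x y z x' z' : z' < z -> x <= x' -> x' + z' < x + z ->
  misere_set x' y z' -> has_move_into x y z.
Proof.
move=> lt_z le_x lt_xz Sp'; exists x', y, z'; split=> //.
by right; exists (z - z'), (x' - x); split; [lia|lia|congr (_, _, _); lia].
Qed.

(* Outside a few small positions, the moves end at [(t, z + t, z)] with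
   [t = y - z] (truncated), at [(y + z, y, z)] and at [(x, y, x - y)]. *)
Lemma max_first_absorbing x y z : 0 < x -> y <= x -> z <= x ->
  ~~ misere_set x y z -> has_move_into x y z.
Proof.
move=> x_gt0 le_yx le_zx nS.
have [gyz|ngyz] := boolP (golden y z); last first.
  have z_gt0 : 0 < z by case: z ngyz {nS le_zx} => //; rewrite golden0.
  (* Here the general target would be [(0, 1, 1)], whose largest coordinate is below 2. *)
  have [yz1|yz1] := boolP ((z == 1) && (y <= 1)).
    case: (posnP y) => [y0|y_gt0].
      by apply: (lower_first _ _ _ 0 0); rewrite ?/misere_set; lia.
    by apply: (lower_first _ _ _ 1 1); move: nS; rewrite /misere_set; lia.
  (* For [y = 0] the target is [(0, z, z)], a legal move only if [z < x]; but [(z, 0, z)] with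
     [2 <= z] is in the set. *)
  have z_lt_x : y = 0 -> z < x.
    move=> y0; move: nS; rewrite /misere_set /apex y0 golden0; lia.
  apply: (lower_first _ _ _ (y - z) (z + (y - z))); [lia..|].
  have gz : golden z (y - z).
    have [le_zy|/ltnW] := leqP z y; first exact: golden_sub.
    by rewrite -subn_eq0 => /eqP ->; exact: golden0.
  by rewrite /misere_set /apex gz; lia.
have z_lt_y : 0 < z -> z < y by move=> z_gt0; exact: golden_lt gyz.
have [lt_x|le_x] := ltnP x (y + z).
- apply: (lower_last _ _ _ x (x - y)); [lia..|].
  have gy : golden y (x - y) by apply: golden_leq gyz; lia.
  by rewrite /misere_set /apex gy; lia.
- have [yz2|yz2] := leqP 2 (y + z).
    apply: (lower_first _ _ _ (y + z) y);
      by move: nS; rewrite /misere_set /apex gyz; lia.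
  (* Now [z = 0] and [y <= 1], so the target has total 1. *)
  apply: (lower_first _ _ _ (1 - y) y);
    by move: nS; rewrite /misere_set; lia.
Qed.

Lemma misere_set_absorbing x y z : 0 < x + y + z -> ~~ misere_set x y z ->
  has_move_into x y z.
Proof.
move=> pos nS.
have : [|| (y <= x) && (z <= x), (z <= y) && (x <= y) | (x <= z) && (y <= z)].
  lia.
case/or3P => /andP [le1 le2].
- by apply: max_first_absorbing => //; lia.
- apply/has_move_intoC/has_move_intoC/max_first_absorbing => //; first lia.
  by rewrite -misere_setC.
- apply/has_move_intoC/max_first_absorbing => //; first lia.
  by rewrite misere_setC.
Qed.

Lemma triangle_terminal x y z :
  terminal triangle_options (x, y, z) <-> x + y + z = 0.
Proof.
split=> [t|xyz0]; last first.
  rewrite /terminal -subset0 => -[[x' y'] z'] /triangle_options_total.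
  by rewrite xyz0.
apply: contrapT => pos.
have stuck x' y' z' : ~ triangle_options (x, y, z) (x', y', z').
  by rewrite t.
have [x0|x_gt0] := posnP x; last first.
  by apply: (stuck (x - 1) (y + 0) z); left; left; exists 1, 0.
have [y0|y_gt0] := posnP y; last first.
  by apply: (stuck x (y - 1) (z + 0)); left; right; exists 1, 0.
apply: (stuck (x + 0) y (z - 1)); right; exists 1, 0; split=> //; lia.
Qed.

Theorem theorem2p7 (R : realType) : S_minus = S_minus1 `|` S_minus2 R.
Proof.
apply: (misere_P_positionE _ (fun p => p.1.1 + p.1.2 + p.2)).
- by move=> [[x y] z] [[x' y'] z'] /triangle_options_total.
- move=> [[x y] z] /misere_setE Sp /triangle_terminal.
  by move: Sp; rewrite /misere_set /apex; lia.
- move=> [[x y] z] [[x' y'] z'] /misere_setE Sp opt /misere_setE.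
  by apply/negP; exact: misere_set_stable opt.
- move=> [[x y] z] nSp /triangle_terminal/eqP; rewrite -lt0n => pos.
  have [|x' [y' [z' [opt Sq]]]] := misere_set_absorbing x y z pos.
    by apply/negP => /(misere_setE R).
  by exists (x', y', z') => //; exact/misere_setE.
Qed.
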